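(* Let $k\ge 2$ and $n\ge 4k^6$ be integers, and let $\mathcal{F}\subseteq\binom{[n]}{k}$ be an intersecting family. Then the number of triangles in $\mathcal{F}$ is at most $n_{3,k}$, and equality holds if and only if $\mathcal{F}'_{X,k}\subseteq\mathcal{F}\subseteq\mathcal{F}_{X,k}$ for some $3$-subset $X$ of $[n]$.
   Context: $\binom{[n]}{k}$ denotes the family of $k$-element subsets of $[n]=\{1,\dots,n\}$. A family $\mathcal{F}$ is intersecting if $F\cap F'\neq\emptyset$ for all $F,F'\in\mathcal{F}$. A triangle in $\mathcal{F}$ is a set of three members $F,F',F''\in\mathcal{F}$ with $F\cap F'\cap F''=\emptyset$ (in an intersecting family any two of them intersect). For a $3$-subset $X\subseteq[n]$, $\mathcal{F}_{X,k}=\{F\in\binom{[n]}{k}:|F\cap X|\ge 2\}$ and $\mathcal{F}'_{X,k}=\{F\in\binom{[n]}{k}:|F\cap X|=2\}$; $n_{3,k}$ is the number of triangles in $\mathcal{F}_{X,k}$ (independent of the choice of $X$). *)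

(* Defs.v *)
From mathcomp Require Import all_boot all_fingroup.

Set Implicit Arguments.
Unset Strict Implicit.
Unset Printing Implicit Defensive.

Section Families.
Variable T : finType.
Implicit Types (F : {set {set T}}) (X A B : {set T}).

Definition ksubsets (k : nat) : {set {set T}} := [set A : {set T} | #|A| == k].

(* A and B may coincide, so a member of an intersecting family is nonempty. *)
Definition intersecting F : Prop :=
  forall A B, A \in F -> B \in F -> A :&: B != set0.

(* A triangle is an unordered set of three (distinct) members with empty
   common intersection. Pairwise intersection is not required: it is automatic
   in an intersecting family, in particular in famX X k when #|X| = 3. *)
Definition triangles F : {set {set {set T}}} :=
  [set S : {set {set T}} |
    [&& S \subset F, #|S| == 3 & \bigcap_(A in S) A == set0]].

Definition famX X (k : nat) : {set {set T}} :=
  [set A in ksubsets k | 2 <= #|A :&: X|].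

Definition famX' X (k : nat) : {set {set T}} :=
  [set A in ksubsets k | #|A :&: X| == 2].

End Families.

(* The ground set [n] = {1, ..., n} is rendered by 'I_n, so its first three
   points are 0, 1, 2. The number of triangles of famX X k is computed at the
   3-set X of these points; n3E below shows that any 3-set X gives the same number. *)
Definition n3 (n k : nat) : nat :=
  #|triangles (famX [set i : 'I_n | i < 3] k)|.

Lemma famX_intersecting (T : finType) (X : {set T}) (k : nat) :
  #|X| = 3 -> intersecting (famX X k).
Proof.
move=> X3 A B; rewrite !inE => /andP[_ hA] /andP[_ hB].
apply/eqP=> AB0.
have /eqP : #|(A :&: X) :|: (B :&: X)| + #|(A :&: X) :&: (B :&: X)|
   = #|A :&: X| + #|B :&: X| by rewrite cardsUI.
rewrite setIACA AB0 set0I cards0 addn0 => /eqP e.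
have := subset_leq_card (subsetIr (A :|: B) X).
rewrite setIUl e X3 => h.
by have := leq_trans (leq_add hA hB) h.
Qed.

Lemma perm_of_card (T : finType) (X Y : {set T}) :
  #|X| = #|Y| -> exists s : {perm T}, s @: X = Y.
Proof.
move=> XY.
pose l (Z : {set T}) := enum Z ++ enum (~: Z).
have lU Z : uniq (l Z).
  rewrite cat_uniq !enum_uniq andbT /=; apply/hasPn=> x.
  by rewrite !mem_enum inE.
have lM Z x : x \in l Z by rewrite mem_cat !mem_enum inE orbN.
have lS Z : size (l Z) = #|T| by rewrite size_cat -!cardE cardsC.
pose f x := nth x (l Y) (index x (l X)).
have f_inj : injective f.
  move=> x y; rewrite /f.
  have ix z : index z (l X) < size (l Y) by rewrite lS -(lS X) index_mem.
  rewrite (set_nth_default y x) // => /eqP.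
  rewrite nth_uniq // => /eqP/(congr1 (nth x (l X))).
  by rewrite !nth_index.
exists (perm f_inj); apply/eqP; rewrite eqEcard card_imset ?XY ?leqnn ?andbT;
  last exact: perm_inj.
apply/subsetP=> _ /imsetP[x xX ->]; rewrite permE /f /l !index_cat !mem_enum xX.
rewrite nth_cat -cardE -XY cardE index_mem mem_enum xX -mem_enum mem_nth //.
by rewrite -cardE -XY cardE index_mem mem_enum.
Qed.

Lemma leq_triangles_famX (T : finType) (X Y : {set T}) (k : nat) :
  #|X| = #|Y| -> #|triangles (famX X k)| <= #|triangles (famX Y k)|.
Proof.
move=> /perm_of_card[s <-].
pose g (A : {set T}) := s @: A.
have g_inj : injective g by apply: imset_inj; apply: perm_inj.
have G_inj : injective (fun S : {set {set T}} => g @: S) by apply: imset_inj.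
rewrite -(card_imset _ G_inj); apply: subset_leq_card.
apply/subsetP=> _ /imsetP[S + ->]; rewrite !inE => /and3P[SF S3 S0].
apply/and3P; split.
- apply/subsetP=> _ /imsetP[A AS ->].
  have := subsetP SF A AS; rewrite !inE -imsetI ?card_imset //.
  + exact: perm_inj.
  + exact: perm_inj.
  + by move=> x y _ _; apply: perm_inj.
- by rewrite card_imset.
- apply/eqP/setP=> y; rewrite inE; apply/negP=> /bigcapP h.
  have: (s^-1)%g y \in \bigcap_(A in S) A.
    apply/bigcapP=> A AS; have /imsetP[x xA ->] := h _ (imset_f g AS).
    by rewrite permK.
  by rewrite (eqP S0) inE.
Qed.

Lemma n3E (n k : nat) (X : {set 'I_n}) :
  #|X| = 3 -> #|triangles (famX X k)| = n3 n k.
Proof.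
move=> X3.
have n3le : 3 <= n by rewrite -X3 -[X in _ <= X]card_ord max_card.
have c3 : #|X| = #|[set i : 'I_n | i < 3]|.
  have -> : [set i : 'I_n | i < 3] = widen_ord n3le @: [set: 'I_3].
    apply/setP=> i; rewrite inE; apply/idP/imsetP=> [i3|[j _ ->]] /=.
      by exists (Ordinal i3); rewrite ?inE //; apply: val_inj.
    exact: ltn_ord.
  by rewrite card_imset ?cardsT ?card_ord // => i j /(congr1 val)/= /val_inj.
by apply/eqP; rewrite eqn_leq /n3 !leq_triangles_famX.
Qed.

(* Main.v *)
(* With M the number of k-sets meeting a 3-set X in a prescribed pair and D the
   number of k-sets containing a prescribed 3-set, n >= 4k^6 gives
   4 k^5 D <= M, and F_{X,k} has at least M^2 (M - kD) triangles: the three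
   traces on X are its three pairs, and disjointness of two members outside X
   is enough.

   Call a pair heavy if it meets every transversal of F of size at most k.  A
   pair that is not heavy lies in at most kD members, and, once F has a triangle,
   k^2 pairs suffice to cover F, so at most k^3 D members contain no heavy pair.
   If there is no heavy pair, |F| <= k^3 D.  If {x,y} is the only one, each
   triangle has a member missing x and another one missing y, both among the
   k^3 D exceptional ones.  Otherwise two heavy pairs {x,y}, {x,z} exist: if
   {y,z} is heavy then F is contained in F_{X,k} for X = {x,y,z}; if not, each
   triangle has a member missing x, hence containing {y,z}, and there are at most
   kD of these.  In all but the containment case there are fewer than
   M^2 (M - kD) triangles. *)
Require Import Defs.
From mathcomp Require Import all_boot zify ring.

Set Implicit Arguments.
Unset Strict Implicit.
Unset Printing Implicit Defensive.

(** * Counting tools, and the traces of triangles on a 3-set *)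

Lemma cards3 (T : finType) (x y z : T) :
  x != y -> x != z -> y != z -> #|[set x; y; z]| = 3.
Proof.
by move=> xy xz yz; rewrite setUC cardsU1 cards2 !inE negb_or ![z == _]eq_sym xz yz xy.
Qed.

Lemma leq_card_cover (I U : finType) (S : {set I}) (G : {set U})
    (H : I -> {set U}) (s c : nat) :
  #|S| <= s ->
  (forall A, A \in G -> exists2 v, v \in S & A \in H v) ->
  (forall v, v \in S -> #|H v| <= c) -> #|G| <= s * c.
Proof.
move=> Ss cov Hc; apply: leq_trans (leq_mul Ss (leqnn c)).
have GU : G \subset \bigcup_(v in S) H v.
  by apply/subsetP=> A /cov[v vS AH]; apply/bigcupP; exists v.
rewrite (leq_trans (subset_leq_card GU)) // -sum_nat_const.
apply: (@leq_trans (\sum_(v in S) #|H v|)); last exact: leq_sum.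
elim/big_rec2: _ => [|v m B _ Bm]; first by rewrite cards0.
by rewrite (leq_trans (leq_card_setU _ _)) // leq_add2l.
Qed.

Lemma leq_card_dep_pairs (U V : finType) (P : {set U}) (Q : U -> {set V}) (c : nat) :
  (forall u, u \in P -> c <= #|Q u|) ->
  #|P| * c <= #|[set p : U * V | (p.1 \in P) && (p.2 \in Q p.1)]|.
Proof.
move=> cQ; rewrite -sum_nat_const -sum1dep_card.
rewrite -(pair_big_dep (mem P) (fun u v => v \in Q u) (fun _ _ => 1)) /=.
by apply: leq_sum => u /cQ; rewrite sum1_card.
Qed.

(** If a member contained [X], the two others, with two points each in the 3-set [X], would share a
    point there that lies in all three. So the sets containing [X] occur in no triangle, which is
    why they are optional in the case of equality. *)
Lemma triangles_famX_sub (T : finType) (k : nat) (X : {set T}) (S : {set {set T}}) :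
  #|X| = 3 -> S \in triangles (famX X k) -> S \subset famX' X k.
Proof.
move=> X3; rewrite inE => /and3P[SF /eqP S3 /eqP S0].
apply/subsetP=> A AS; have := subsetP SF _ AS; rewrite !inE => /andP[-> A2] /=.
rewrite eqn_leq A2 andbT leqNgt; apply/negP=> A3.
have XA : X \subset A.
  have /eqP <- : A :&: X == X by rewrite eqEcard subsetIr X3.
  exact: subsetIl.
have /cards2P[B [C [BC SA]]] : #|S :\ A| == 2.
  by move: S3; rewrite (cardsD1 A) AS add1n => -[->].
have /setD1P[_ BS] : B \in S :\ A by rewrite SA !inE eqxx.
have /setD1P[_ CS] : C \in S :\ A by rewrite SA !inE eqxx orbT.
have := subsetP SF _ BS; have := subsetP SF _ CS.
rewrite !inE => /andP[_ C2] /andP[_ B2].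
have : #|(B :&: X) :|: (C :&: X)| <= 3.
  by rewrite -X3 subset_leq_card // subUset !subsetIr.
rewrite cardsU => le3.
have : 0 < #|B :&: X :&: (C :&: X)| by lia.
rewrite card_gt0 => /set0Pn[w]; rewrite !inE => /andP[/andP[wB wX] /andP[wC _]].
have : w \in \bigcap_(Z in S) Z; last by rewrite S0 inE.
apply/bigcapP=> Z ZS; have [->|ZA] := eqVneq Z A; first exact: (subsetP XA).
have : Z \in S :\ A by rewrite !inE ZA.
by rewrite SA !inE => /orP[] /eqP->.
Qed.

(** * Counting [k]-sets by trace, and the triangles of [famX X k] *)

Section Counting.
Variables (T : finType) (k : nat).
Implicit Types (x y z v : T) (A B C P Q S W X Y : {set T}) (F : {set {set T}}).

(** Removing [Y] gives a bijection with the draws of [k - #|Y|] points outside [W]; the boolean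
    factor covers the case where this subtraction truncates. *)
Lemma card_trace W Y : Y \subset W ->
  #|[set A in ksubsets T k | A :&: W == Y]|
    = (#|Y| <= k) * 'C(#|T| - #|W|, k - #|Y|).
Proof.
move=> YW; case: (leqP #|Y| k) => [Yk|kY] /=; last first.
  apply/eqP; rewrite mul0n cards_eq0; apply/eqP/setP=> A; rewrite !inE.
  apply/negP=> /andP[/eqP Ak /eqP AY].
  by have := subset_leq_card (subsetIl A W); rewrite AY Ak leqNgt kY.
have cW : #|~: W| = #|T| - #|W| by rewrite -(cardsC W) addKn.
rewrite mul1n -cW -cards_draws.
have inj : {in [set A : {set T} | A \subset ~: W & #|A| == k - #|Y|] &,
    injective (fun A => A :|: Y)}.
  move=> A B; rewrite !inE => /andP[AW _] /andP[BW _] AB.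
  have h (Z : {set T}) : Z \subset ~: W -> (Z :|: Y) :\: W = Z.
    move=> ZW; rewrite setDUl (eqP (_ : Y :\: W == set0)) ?setD_eq0 // setU0.
    by apply/setDidPl; rewrite disjoints_subset.
  by rewrite -(h A AW) AB h.
rewrite -(card_in_imset inj); apply: eq_card => A.
rewrite !inE; apply/andP/imsetP=> [[/eqP Ak /eqP AY]|[B + ->]].
  exists (A :\: W); last by rewrite -AY setUC setID.
  by rewrite inE subsetDr /= -AY -Ak -(cardsID W A) addKn.
rewrite inE => /andP[BW /eqP Bk].
have BW0 : B :&: W = set0.
  by apply/eqP; rewrite setI_eq0 disjoints_subset.
have BY0 : B :&: Y = set0.
  by apply/eqP; rewrite -subset0 -BW0 setIS.
split; first by rewrite cardsU BY0 cards0 subn0 Bk subnK.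
by rewrite setIUl BW0 set0U; apply/eqP/setIidPl.
Qed.

Definition supersets S := [set A in ksubsets T k | S \subset A].

Lemma card_supersets S : #|supersets S| = (#|S| <= k) * 'C(#|T| - #|S|, k - #|S|).
Proof.
rewrite -card_trace //; apply: eq_card => A; rewrite !inE; congr andb.
by apply/setIidPr/eqP.
Qed.

(* The factor [3 <= k] guards against the truncation k - 3 = 0 at k = 2. *)
Definition codeg3 := (3 <= k) * 'C(#|T| - 3, k - 3).
Definition trace_deg := 'C(#|T| - 3, k - 2).
Local Notation D := codeg3.
Local Notation M := trace_deg.

Hypothesis k2 : 2 <= k.
Hypothesis nk : 4 * k ^ 6 <= #|T|.

Lemma leq_3k_card : 3 * k <= #|T|.
Proof.
apply: leq_trans nk; rewrite expnS.
have : 0 < k ^ 5 by rewrite expn_gt0; lia.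
by nia.
Qed.

Lemma trace_deg_gt0 : 0 < M.
Proof.
by rewrite /M bin_gt0; have := leq_3k_card; lia.
Qed.

Lemma card_supersets3 S : #|S| = 3 -> #|supersets S| = D.
Proof. by move=> S3; rewrite card_supersets S3. Qed.

(** This is Pascal's rule. For [k = 2] both sides are 1, since the guard makes [D] vanish. *)
Lemma card_supersets2 S : #|S| = 2 -> #|supersets S| = M + D.
Proof.
move=> S2; rewrite card_supersets S2 k2 mul1n /M /D.
have -> : #|T| - 2 = (#|T| - 3).+1 by have := leq_3k_card; lia.
case: (leqP 3 k) => k3; last by rewrite (_ : k - 2 = 0) ?bin0 ?mul0n ?addn0 //; lia.
by have -> : k - 2 = (k - 3).+1; [lia | rewrite binS mul1n].
Qed.

(** For [3 <= k], consecutive binomials satisfy [(k - 2) * M = (#|T| - k) * D], and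
    [4 * k ^ 6 <= #|T|] makes [#|T| - k] at least [(k - 2) * (4 * k ^ 5)]. *)
Lemma codeg3_le : 4 * k ^ 5 * D <= M.
Proof.
rewrite /D; case: (leqP 3 k) => k3; last by rewrite mul0n muln0.
rewrite mul1n /M; have := mul_bin_left (#|T| - 3) (k - 3).
have -> : (k - 3).+1 = k - 2 by lia.
set d := 'C(_, k - 3); set m := 'C(_, _) => e.
have kn : (k - 2) * (4 * k ^ 5) <= #|T| - 3 - (k - 3).
  have : k <= k ^ 5 by rewrite -{1}(expn1 k) leq_pexp2l //; lia.
  by move: nk; rewrite expnS; nia.
rewrite -(leq_pmul2l (_ : 0 < k - 2)); last by lia.
by rewrite e mulnA leq_mul.
Qed.

Definition trace_class X P := [set A in ksubsets T k | A :&: X == P].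

Lemma card_trace_class X P :
  #|X| = 3 -> P \subset X -> #|P| = 2 -> #|trace_class X P| = M.
Proof. by move=> X3 PX P2; rewrite card_trace // P2 X3 k2 mul1n. Qed.

(** A set [B] of the class that is left out contains [P] and a point of [A] outside [X], hence one
    of at most [k] 3-sets, each lying in [D] sets of size [k]. *)
Lemma card_trace_class_avoid X P A :
  #|X| = 3 -> P \subset X -> #|P| = 2 -> #|A| = k ->
  M - k * D <= #|[set B in trace_class X P | A :&: B \subset X]|.
Proof.
move=> X3 PX P2 Ak; rewrite leq_subLR -(card_trace_class X3 PX P2).
rewrite -(cardsID [set B | A :&: B \subset X]) addnC.
apply: leq_add; last by apply: subset_leq_card; apply/subsetP=> B; rewrite !inE.
apply: (@leq_card_cover _ _ (A :\: X) _ (fun v => supersets (v |: P))).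
- by rewrite -Ak subset_leq_card ?subsetDl.
- move=> B; rewrite !inE => /andP[/subsetPn[v]]; rewrite inE => /andP[vA vB] vX.
  move=> /andP[Bk /eqP BX]; exists v; first by rewrite inE vX.
  by rewrite !inE Bk subUset sub1set vB -BX subsetIl.
- move=> v; rewrite inE => /andP[vX _]; rewrite card_supersets3 // cardsU1 P2.
  by rewrite (contra _ vX) //; apply: (subsetP PX).
Qed.

Lemma triangle_of_traces x y z A B C :
  x != y -> x != z -> y != z -> let X := [set x; y; z] in
  A \in trace_class X [set x; y] -> B \in trace_class X [set x; z] ->
  C \in trace_class X [set y; z] -> A :&: B \subset X ->
  [set A; B; C] \in triangles (famX X k).
Proof.
move=> xy xz yz X; rewrite !inE.
move=> /andP[Ak /eqP AX] /andP[Bk /eqP BX] /andP[Ck /eqP CX] ABX.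
have eX Z W w : Z :&: X = W -> w \in X -> (w \in Z) = (w \in W).
  by move=> <- wX; rewrite inE wX andbT.
have xX : x \in X by rewrite !inE eqxx.
have yX : y \in X by rewrite !inE eqxx orbT.
have zX : z \in X by rewrite !inE eqxx orbT.
have [[Ax Ay] Az] := (eX _ _ _ AX xX, eX _ _ _ AX yX, eX _ _ _ AX zX).
have [[Bx By] Bz] := (eX _ _ _ BX xX, eX _ _ _ BX yX, eX _ _ _ BX zX).
have [[Cx Cy] Cz] := (eX _ _ _ CX xX, eX _ _ _ CX yX, eX _ _ _ CX zX).
move: xy xz yz Ax Ay Az Bx By Bz Cx Cy Cz; rewrite !inE !eqxx ?orbT /=.
rewrite ![_ == x]eq_sym [z == y]eq_sym => xy xz yz.
rewrite (negPf xy) (negPf xz) (negPf yz) /= => Ax Ay Az Bx By Bz Cx Cy Cz.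
have AB : A != B by apply/eqP=> e; move: Az; rewrite e Bz.
have AC : A != C by apply/eqP=> e; move: Ax; rewrite e Cx.
have BC : B != C by apply/eqP=> e; move: Bx; rewrite e Cx.
apply/and3P; split.
- apply/subsetP=> Z; rewrite !inE -orbA => /or3P[] /eqP->.
  + by rewrite Ak AX cards2 xy.
  + by rewrite Bk BX cards2 xz.
  + by rewrite Ck CX cards2 yz.
- by rewrite cards3.
- apply/eqP/setP=> w; rewrite inE; apply/negP=> /bigcapP h.
  have wA : w \in A by apply: h; rewrite !inE eqxx.
  have wB : w \in B by apply: h; rewrite !inE eqxx orbT.
  have wC : w \in C by apply: h; rewrite !inE eqxx orbT.
  have : w \in X by apply: (subsetP ABX); rewrite inE wA.
  rewrite !inE -orbA => /or3P[] /eqP e; subst w.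
  + by rewrite Cx in wC.
  + by rewrite By in wB.
  + by rewrite Az in wA.
Qed.

Lemma leq_card_triangles_famX x y z :
  x != y -> x != z -> y != z ->
  M * ((M - k * D) * M) <= #|triangles (famX [set x; y; z] k)|.
Proof.
move=> xy xz yz; set X := [set x; y; z].
have X3 : #|X| = 3 by apply: cards3.
have XxyS : [set x; y] \subset X by rewrite subsetUl.
have XxzS : [set x; z] \subset X by rewrite subUset !sub1set !inE !eqxx ?orbT.
have XyzS : [set y; z] \subset X by rewrite subUset !sub1set !inE !eqxx ?orbT.
(* The second member is restricted by the first; the third is free. *)
pose Q (A : {set T}) :=
  setX [set B in trace_class X [set x; z] | A :&: B \subset X]
       (trace_class X [set y; z]).
have cP : #|trace_class X [set x; y]| = M by apply: card_trace_class; rewrite ?cards2 ?xy.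
rewrite -{1}cP; apply: (@leq_trans _ _ _ (leq_card_dep_pairs (Q := Q) _)) => [A|].
  rewrite !inE => /andP[/eqP Ak _]; rewrite cardsX.
  rewrite (card_trace_class X3 XyzS) ?cards2 ?yz // leq_mul //.
  by rewrite card_trace_class_avoid ?cards2 ?xz.
pose g (p : {set T} * ({set T} * {set T})) := [set p.1; p.2.1; p.2.2].
(* [g] forgets the order, but the traces on [X] are three different pairs and tell which member is
   which, so no triangle is counted twice. *)
rewrite -(@card_in_imset _ _ g); last first.
  have nxz : [set x; y] <> [set x; z].
    move/setP/(_ y); rewrite !inE eqxx orbT; move: xy yz.
    by rewrite eq_sym => /negPf-> /negPf->.
  have nyz : [set x; y] <> [set y; z].
    by move/setP/(_ x); rewrite !inE eqxx (negPf xy) (negPf xz).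
  have nzz : [set x; z] <> [set y; z].
    by move/setP/(_ x); rewrite !inE eqxx (negPf xy) (negPf xz).
  move=> [A [B C]] [A' [B' C']]; rewrite !inE /=.
  move=> /andP[/andP[_ /eqP AX] /andP[/andP[/andP[_ /eqP BX] _] /andP[_ /eqP CX]]].
  move=> /andP[/andP[_ /eqP AX'] /andP[/andP[/andP[_ /eqP BX'] _] /andP[_ /eqP CX']]].
  rewrite /g /= => /setP e.
  have := e A; have := e B; have := e C; rewrite !inE !eqxx ?orbT /=.
  move=> /esym/orP[/orP[]|] /eqP eC /esym/orP[/orP[]|] /eqP eB /esym/orP[/orP[]|] /eqP eA;
    by subst; congruence.
apply: subset_leq_card; apply/subsetP=> _ /imsetP[[A [B C]] + ->].
rewrite inE /= => /andP[AX]; rewrite inE /= inE => /andP[/andP[BX AB] CX].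
exact: triangle_of_traces.
Qed.

(** Ensures that the truncated difference [M - k * D] is positive. *)
Lemma codeg3_lt : k * D < M.
Proof.
have := codeg3_le; have := trace_deg_gt0; rewrite expnS.
have : 0 < k ^ 4 by rewrite expn_gt0; lia.
set d := D; set m := M; set q := k ^ 4 => q0 m0 h.
have : 4 * (k * d) <= m by apply: leq_trans h; nia.
by lia.
Qed.

(** Serves the case of equality: a family that has all triangles of [famX X k] must contain
    [famX' X k]. The partners of [A] come from the two other trace classes. *)
Lemma famX'_in_triangle X A :
  #|X| = 3 -> A \in famX' X k -> exists2 S, S \in triangles (famX X k) & A \in S.
Proof.
move=> X3; rewrite inE => /andP[Ak /cards2P[x [y [xy AX]]]].
have xyX : [set x; y] \subset X by rewrite -AX subsetIr.
have /cards1P[z Xz] : #|X :\: [set x; y]| == 1.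
  by rewrite cardsD (setIidPr xyX) X3 cards2 xy.
have /setDP[zX] : z \in X :\: [set x; y] by rewrite Xz inE.
rewrite !inE negb_or => /andP[zx zy].
have eX : X = [set x; y; z].
  by rewrite -Xz -[LHS](setID _ [set x; y]) (setIidPr xyX).
rewrite eq_sym in zx; rewrite eq_sym in zy.
have XxzS : [set x; z] \subset X by rewrite eX subUset !sub1set !inE !eqxx ?orbT.
have XyzS : [set y; z] \subset X by rewrite eX subUset !sub1set !inE !eqxx ?orbT.
have : 0 < #|[set B in trace_class X [set x; z] | A :&: B \subset X]|.
  apply: leq_trans (card_trace_class_avoid X3 XxzS _ _); last 1 first.
  - by move: Ak; rewrite inE => /eqP.
  - by rewrite subn_gt0 codeg3_lt.
  - by rewrite cards2 zx.
have : 0 < #|trace_class X [set y; z]|.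
  by rewrite (card_trace_class X3 XyzS) ?cards2 ?zy // trace_deg_gt0.
rewrite !card_gt0 => /set0Pn[C CX] /set0Pn[B]; rewrite inE => /andP[BX AB].
exists [set A; B; C]; last by rewrite !inE eqxx.
rewrite eX; apply: triangle_of_traces; rewrite -?eX //.
by rewrite inE Ak AX eqxx.
Qed.

End Counting.

(** * Picking members of a triangle *)

Lemma triangle_two_members (T : finType) (S : {set {set T}}) (A B : {set T}) :
  #|S| = 3 -> A \in S -> B \in S -> A != B ->
  exists2 C, C \in S & S = [set A; B; C].
Proof.
move=> S3 AS BS AB.
have ABS : [set A; B] \subset S by rewrite subUset !sub1set AS.
have /cards1P[C SC] : #|S :\: [set A; B]| == 1.
  by rewrite cardsD (setIidPr ABS) S3 cards2 AB.
exists C; first by have /setDP[] : C \in S :\: [set A; B] by rewrite SC inE.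
by rewrite -SC -[LHS](setID _ [set A; B]) (setIidPr ABS).
Qed.

Lemma triangle_avoids (T : finType) (F S : {set {set T}}) (x : T) :
  S \in triangles F -> exists2 A, A \in S & x \notin A.
Proof.
rewrite inE => /and3P[_ _ /eqP S0]; apply/exists_inP; rewrite -negb_forall_in.
apply/negP=> /forall_inP h; suff : x \in \bigcap_(A in S) A by rewrite S0 inE.
exact/bigcapP.
Qed.

(** Ordered triples map onto the triangles. The factor lost by ignoring symmetry is harmless, as the
    bounds below have room to spare. *)
Lemma leq_card_triangles (T : finType) (F P Q R : {set {set T}}) :
  (forall S, S \in triangles F -> exists A B C,
     [/\ S = [set A; B; C], A \in P, B \in Q & C \in R]) ->
  #|triangles F| <= #|P| * #|Q| * #|R|.
Proof.
move=> h; rewrite -!cardsX.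
pose g (p : {set T} * {set T} * {set T}) := [set p.1.1; p.1.2; p.2].
apply: leq_trans (leq_imset_card g _); apply: subset_leq_card.
apply/subsetP=> S /h[A [B [C [-> AP BQ CR]]]]; apply/imsetP.
by exists (A, B, C); rewrite ?inE //= AP BQ CR.
Qed.

(** * Heavy pairs and upper bounds on the number of triangles *)

Section HeavyPairs.
Variables (T : finType) (k : nat) (F : {set {set T}}).
Implicit Types (x y z v : T) (A B C P Q S W X Y : {set T}).
Local Notation D := (codeg3 T k).
Local Notation M := (trace_deg T k).

Hypothesis k2 : 2 <= k.
Hypothesis nk : 4 * k ^ 6 <= #|T|.
Hypothesis FK : F \subset ksubsets T k.
Hypothesis FI : intersecting F.
(** Any single triangle of [F] provides this, its members having no common point. *)
Hypothesis F_avoids : forall x, exists2 A, A \in F & x \notin A.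

(* Members of [F] and heavy pairs are themselves transversals of size at most [k],
   so a heavy pair meets all of them. *)
Definition heavy P : bool :=
  [forall S : {set T}, (#|S| <= k) && [forall A in F, S :&: A != set0]
                       ==> (P :&: S != set0)].

Lemma card_member A : A \in F -> #|A| = k.
Proof. by move/(subsetP FK); rewrite inE => /eqP. Qed.

Lemma heavy_meets P A : heavy P -> A \in F -> P :&: A != set0.
Proof.
move=> /forallP/(_ A)/implyP h AF; apply: h; rewrite card_member // leqnn.
by apply/forall_inP=> B; apply: FI.
Qed.

Lemma heavy_meets_heavy P Q : heavy P -> heavy Q -> #|Q| = 2 -> P :&: Q != set0.
Proof.
move=> /forallP/(_ Q)/implyP h hQ Q2; apply: h; rewrite Q2 k2.
by apply/forall_inP=> B; apply: heavy_meets.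
Qed.

(** A transversal [S] of size at most [k] disjoint from [P] exists, and each member containing [P]
    also contains a point of [S], hence one of at most [k] 3-sets. *)
Lemma card_members_light P :
  #|P| = 2 -> ~~ heavy P -> #|[set A in F | P \subset A]| <= k * D.
Proof.
move=> P2; rewrite negb_forall => /existsP[S].
rewrite negb_imply negbK => /andP[/andP[Sk /forall_inP hS] /eqP PS0].
apply: (leq_card_cover (H := fun v => supersets k (v |: P)) Sk) => [A|v vS].
  rewrite inE => /andP[AF PA]; have /set0Pn[v] := hS A AF.
  rewrite inE => /andP[vS vA]; exists v => //.
  by rewrite !inE card_member // eqxx subUset sub1set vA.
rewrite card_supersets3 // cardsU1 P2.
suff -> : v \notin P by [].
by apply/negP=> vP; have := in_set0 v; rewrite -PS0 inE vP vS.
Qed.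

Lemma card_members_sup2 P : #|P| = 2 -> #|[set A in F | P \subset A]| <= M + D.
Proof.
move=> P2; rewrite -(card_supersets2 k2 nk P2); apply: subset_leq_card.
by apply/subsetP=> A; rewrite !inE => /andP[/card_member -> ->]; rewrite eqxx.
Qed.

(** Branch twice: a member [A] meets a fixed [A0] in some [x], and meets a member [B] avoiding [x]
    in some [y], necessarily different from [x]. This leaves at most [k ^ 2] pairs. The filter [p]
    lets one argument serve for bad members and for all of [F]. *)
Lemma card_members_by_pairs (p : pred {set T}) (c : nat) :
  (forall P, #|P| = 2 -> #|[set A in F | p A && (P \subset A)]| <= c) ->
  #|[set A in F | p A]| <= k * (k * c).
Proof.
move=> hp; have [->|/set0Pn[A0]] := eqVneq F set0.
  by rewrite (eq_card0 (_ : _ =i pred0)) // => A; rewrite !inE.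
move=> A0F; have A0k : #|A0| <= k by rewrite card_member.
apply: (leq_card_cover (H := fun x => [set A in F | p A && (x \in A)]) A0k).
  move=> A; rewrite inE => /andP[AF pA].
  have /set0Pn[x] := FI A0F AF; rewrite inE => /andP[xA0 xA].
  by exists x; rewrite // inE AF pA xA.
move=> x _; have [B BF xB] := F_avoids x.
have Bk : #|B| <= k by rewrite card_member.
apply: (leq_card_cover
  (H := fun y => [set A in F | p A && ([set x; y] \subset A)]) Bk).
  move=> A; rewrite inE => /and3P[AF pA xA].
  have /set0Pn[y] := FI BF AF; rewrite inE => /andP[yB yA].
  by exists y; rewrite // inE AF pA subUset !sub1set xA yA.
move=> y yB; apply: hp; rewrite cards2; suff -> : x != y by [].
by apply: contraNneq xB => ->.
Qed.

Definition bad A : bool :=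
  ~~ [exists P : {set T}, [&& #|P| == 2, heavy P & P \subset A]].

Lemma card_bad : #|[set A in F | bad A]| <= k * (k * (k * D)).
Proof.
apply: card_members_by_pairs => P P2; case: (boolP (heavy P)) => hP.
  rewrite (eq_card0 (_ : _ =i pred0)) // => A; rewrite !inE.
  apply/negP=> /and3P[_ /existsPn/(_ P)].
  by rewrite P2 eqxx hP => /negP.
apply: leq_trans (card_members_light P2 hP); apply: subset_leq_card.
by apply/subsetP=> A; rewrite !inE => /and3P[-> _ ->].
Qed.

Lemma card_F_le : #|F| <= k * (k * (M + D)).
Proof.
have -> : F = [set A in F | predT A] by apply/setP=> A; rewrite inE andbT.
apply: card_members_by_pairs => P P2.
apply: leq_trans (card_members_sup2 P2); apply: subset_leq_card.
by apply/subsetP=> A; rewrite !inE.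
Qed.

Lemma sub_triangle (S : {set {set T}}) A : S \in triangles F -> A \in S -> A \in F.
Proof. by rewrite inE => /and3P[/subsetP SF _ _]; apply: SF. Qed.

Lemma card3_triangle (S : {set {set T}}) : S \in triangles F -> #|S| = 3.
Proof. by rewrite inE => /and3P[_ /eqP]. Qed.

Lemma few_triangles_no_heavy :
  (forall P, #|P| = 2 -> ~~ heavy P) ->
  #|triangles F| <= k * (k * (k * D)) * (k * (k * (k * D))) * (k * (k * (k * D))).
Proof.
move=> nh; have FD : #|F| <= k * (k * (k * D)).
  have -> : F = [set A in F | predT A] by apply/setP=> A; rewrite inE andbT.
  apply: card_members_by_pairs => P P2.
  apply: leq_trans (card_members_light P2 (nh P P2)); apply: subset_leq_card.
  by apply/subsetP=> A; rewrite !inE.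
apply: (@leq_trans (#|F| * #|F| * #|F|)); last by rewrite !leq_mul.
apply: leq_card_triangles => S ST; have S3 := card3_triangle ST.
have /card_gt1P[A [B [AS BS AB]]] : 1 < #|S| by rewrite S3.
have [C CS eS] := triangle_two_members S3 AS BS AB.
by exists A, B, C; split; rewrite // (sub_triangle ST).
Qed.

Lemma few_triangles_one_heavy P :
  #|P| = 2 -> heavy P -> (forall Q, #|Q| = 2 -> heavy Q -> Q = P) ->
  #|triangles F| <= k * (k * (k * D)) * (k * (k * (k * D)))
                      * (M + D + k * (k * (k * D))).
Proof.
move=> P2 hP uP; set G := [set A in F | bad A].
have badN A x : A \in F -> x \in P -> x \notin A -> A \in G.
  move=> AF xP xA; rewrite inE AF; apply/negP=> /existsP[Q /and3P[/eqP Q2 hQ]].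
  by rewrite (uP _ Q2 hQ) => /subsetP/(_ x xP); rewrite (negPf xA).
have FG : #|F| <= M + D + k * (k * (k * D)).
  apply: leq_trans (leq_add (card_members_sup2 P2) card_bad).
  apply: leq_trans (leq_card_setU _ _); apply: subset_leq_card.
  apply/subsetP=> A AF; rewrite !inE AF /=; case: (boolP (P \subset A)) => //=.
  by case/subsetPn=> x xP xA; have := badN A x AF xP xA; rewrite inE AF.
apply: (@leq_trans (#|G| * #|G| * #|F|)); last by rewrite !leq_mul ?card_bad.
apply: leq_card_triangles => S ST; have S3 := card3_triangle ST.
have /cards2P[x [y [xy eP]]] : #|P| == 2 by rewrite P2.
have [A AS xA] := triangle_avoids x ST; have [B BS yB] := triangle_avoids y ST.
have [AF BF] := (sub_triangle ST AS, sub_triangle ST BS).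
(* A common value would miss both points of the heavy pair [P], which meets every member. *)
have AB : A != B.
  apply: contraTneq (heavy_meets hP AF) => eAB; rewrite negbK -subset0.
  apply/subsetP=> w; rewrite eP !inE => /andP[/orP[]/eqP->].
    by rewrite (negPf xA).
  by rewrite eAB (negPf yB).
have [C CS eS] := triangle_two_members S3 AS BS AB.
exists A, B, C; split=> //; last exact: sub_triangle CS.
  by apply: badN xA; rewrite // eP !inE eqxx.
by apply: badN yB; rewrite // eP !inE eqxx orbT.
Qed.

Lemma few_triangles_path x y z :
  y != z -> heavy [set x; y] -> heavy [set x; z] -> ~~ heavy [set y; z] ->
  #|triangles F| <= k * D * (k * (k * (M + D))) * (k * (k * (M + D))).
Proof.
move=> yz hxy hxz lyz; set G := [set A in F | [set y; z] \subset A].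
apply: (@leq_trans (#|G| * #|F| * #|F|)); last first.
  by rewrite !leq_mul ?card_F_le // card_members_light // cards2 yz.
apply: leq_card_triangles => S ST; have S3 := card3_triangle ST.
have [A AS xA] := triangle_avoids x ST; have AF := sub_triangle ST AS.
have meet w : heavy [set x; w] -> w \in A.
  move/heavy_meets/(_ AF)/set0Pn=> [u]; rewrite !inE => /andP[/orP[]/eqP->] //.
  by rewrite (negPf xA).
have /card_gt0P[B] : 0 < #|S :\ A| by move: S3; rewrite (cardsD1 A) AS; lia.
move=> /setD1P[BA BS]; rewrite eq_sym in BA.
have [C CS eS] := triangle_two_members S3 AS BS BA.
exists A, B, C; split=> //; try exact: sub_triangle ST _.
by rewrite inE AF subUset !sub1set !meet.
Qed.

(** A set meeting all three pairs of a 3-set misses at most one of its points. *)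
Lemma heavy_triangle_famX x y z :
  x != y -> x != z -> y != z ->
  heavy [set x; y] -> heavy [set x; z] -> heavy [set y; z] ->
  F \subset famX [set x; y; z] k.
Proof.
move=> xy xz yz hxy hxz hyz; apply/subsetP=> A AF; rewrite !inE.
rewrite card_member // eqxx /=.
have meet u w : heavy [set u; w] -> (u \in A) || (w \in A).
  move/heavy_meets/(_ AF)/set0Pn=> [v]; rewrite !inE.
  by case/andP=> /orP[]/eqP-> ->; rewrite ?orbT.
have two u w : u != w -> u \in A -> w \in A -> u \in [set x; y; z] ->
    w \in [set x; y; z] -> 2 <= #|A :&: [set x; y; z]|.
  move=> uw uA wA uX wX; apply/card_gt1P; exists u, w.
  by rewrite !inE uA wA in uX wX *.
have := meet _ _ hxy; have := meet _ _ hxz; have := meet _ _ hyz.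
case: (boolP (x \in A)) => xA; case: (boolP (y \in A)) => yA;
  case: (boolP (z \in A)) => zA //= _ _ _.
- by apply: (two x y); rewrite ?inE ?eqxx ?orbT.
- by apply: (two x y); rewrite ?inE ?eqxx ?orbT.
- by apply: (two x z); rewrite ?inE ?eqxx ?orbT.
- by apply: (two y z); rewrite ?inE ?eqxx ?orbT.
Qed.

(** * Comparison of the upper bounds with the lower bound for [famX X k] *)

Lemma bounds_lt (b : nat) :
  [\/ b <= k * (k * (k * D)) * (k * (k * (k * D))) * (k * (k * (k * D))),
      b <= k * (k * (k * D)) * (k * (k * (k * D))) * (M + D + k * (k * (k * D)))
    | b <= k * D * (k * (k * (M + D))) * (k * (k * (M + D)))] ->
  b < M * ((M - k * D) * M).
Proof.
have := codeg3_le k2 nk; have := trace_deg_gt0 k2 nk.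
set d := D; set m := M => m0 hd.
set a := k * (k * (k * d)); set c := k * d.
(* With [2 <= k], the factors [4 * k ^ 2], [4 * k ^ 4] and [4 * k ^ 5] are at least 16, 64 and 128,
   the constants used below. *)
have k1 : 2 ^ 2 <= k ^ 2 by rewrite leq_exp2r.
have k4 : 2 ^ 4 <= k ^ 4 by rewrite leq_exp2r.
have k5 : 2 ^ 5 <= k ^ 5 by rewrite leq_exp2r.
have ha : 16 * a <= m.
  apply: leq_trans hd; rewrite (_ : 4 * k ^ 5 * d = 4 * k ^ 2 * a); last first.
    by rewrite /a; ring.
  by rewrite leq_mul //; lia.
have hc : 64 * c <= m.
  apply: leq_trans hd; rewrite (_ : 4 * k ^ 5 * d = 4 * k ^ 4 * c); last first.
    by rewrite /c; ring.
  by rewrite leq_mul //; lia.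
have hdm : 128 * d <= m by apply: leq_trans hd; rewrite leq_mul //; lia.
(* It suffices to bound [b] by [m * (q * m)]; the three cases take [q] to be [a], [2 * a] and
   [2 * k ^ 5 * d]. *)
have suff_lt q : q < m - c -> m * (q * m) < m * ((m - c) * m).
  by move=> qm; rewrite ltn_mul2l ltn_mul2r m0.
case=> hb; apply: (leq_ltn_trans hb).
- apply: (@leq_ltn_trans (m * (a * m))); last by apply: suff_lt; lia.
  by rewrite -mulnA !leq_mul //; lia.
- apply: (@leq_ltn_trans (m * (2 * a * m))); last by apply: suff_lt; lia.
  rewrite (_ : m * (2 * a * m) = m * a * (2 * m)); last by ring.
  by rewrite !leq_mul //; lia.
(* This case needs the full power [k ^ 5] of [codeg3_le]: [2 * p] is at most half of [m], the 2
   absorbing [(m + d) * (m + d) <= 2 * (m * m)]. *)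
- set p := k ^ 5 * d.
  rewrite (_ : _ * _ = p * ((m + d) * (m + d))); last by rewrite /p /c; ring.
  have hp : 4 * p <= m by rewrite mulnA.
  apply: (@leq_ltn_trans (m * (2 * p * m))); last by apply: suff_lt; lia.
  rewrite (_ : m * (2 * p * m) = p * (2 * (m * m))); last by ring.
  by rewrite leq_mul //; nia.
Qed.

Lemma triangles_lt :
  (forall X, #|X| = 3 -> ~~ (F \subset famX X k)) ->
  #|triangles F| < M * ((M - k * D) * M).
Proof.
move=> nX; apply: bounds_lt.
case: (boolP [exists P : {set T}, (#|P| == 2) && heavy P]) => [|/existsPn nh]; last first.
  constructor 1; apply: few_triangles_no_heavy => P P2.
  by have := nh P; rewrite P2 eqxx.
case/existsP=> P /andP[/eqP P2 hP].
case: (boolP [forall Q : {set T}, (#|Q| == 2) && heavy Q ==> (Q == P)]) => [/forallP uP|].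
  constructor 2; apply: (few_triangles_one_heavy P2 hP) => Q Q2 hQ.
  by have := uP Q; rewrite Q2 eqxx hQ => /eqP.
rewrite negb_forall => /existsP[Q]; rewrite negb_imply => /andP[/andP[/eqP Q2 hQ] QP].
(* [Q] is itself a small transversal, so the two distinct heavy pairs share a point. *)
have /set0Pn[x] := heavy_meets_heavy hP hQ Q2; rewrite inE => /andP[xP xQ].
have other (R : {set T}) : #|R| = 2 -> x \in R -> exists2 y, x != y & R = [set x; y].
  move=> R2 xR; have /cards1P[y Ry] : #|R :\ x| == 1.
    by move: R2; rewrite (cardsD1 x) xR add1n => -[->].
  exists y; last by rewrite -Ry setD1K.
  have /setD1P[yx _] : y \in R :\ x by rewrite Ry inE.
  by rewrite eq_sym.
have [y xy eP] := other P P2 xP; have [z xz eQ] := other Q Q2 xQ.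
rewrite eP in hP QP; rewrite eQ in hQ QP.
have yz : y != z by apply: contraNneq QP => ->.
constructor 3; apply: (few_triangles_path yz hP hQ); apply/negP=> hyz.
by have /negP[] := nX _ (cards3 xy xz yz); apply: heavy_triangle_famX.
Qed.

End HeavyPairs.

(** * The bound and the case of equality *)

Theorem theorem1 (n k : nat) (F : {set {set 'I_n}}) :
  2 <= k ->
  4 * k ^ 6 <= n ->
  F \subset ksubsets 'I_n k ->
  intersecting F ->
  #|triangles F| <= n3 n k
  /\ (#|triangles F| = n3 n k <->
      exists X : {set 'I_n},
        #|X| = 3 /\ famX' X k \subset F /\ F \subset famX X k).
Proof.
move=> k2 nk FK FI.
have nk' : 4 * k ^ 6 <= #|'I_n| by rewrite card_ord.
have triS (G H : {set {set 'I_n}}) : G \subset H -> triangles G \subset triangles H.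
  move=> GH; apply/subsetP=> S; rewrite !inE => /and3P[SG -> ->].
  by rewrite (subset_trans SG GH).
case: (boolP [exists X : {set 'I_n}, (#|X| == 3) && (F \subset famX X k)]).
  case/existsP=> X /andP[/eqP X3 FX]; have TX := triS _ _ FX.
  split; first by rewrite -(n3E k X3) subset_leq_card.
  split=> [eT|[Y [Y3 [F'Y FY]]]].
    (* Equal counts and inclusion give [F] all triangles of [famX X k], and these cover
       [famX' X k]. *)
    exists X; split=> //; split=> //; apply/subsetP=> A.
    case/(famX'_in_triangle k2 nk' X3)=> S SX AS.
    have /eqP eTX : triangles F == triangles (famX X k).
      by rewrite eqEcard TX eT (n3E k X3) leqnn.
    by move: SX; rewrite -eTX inE => /and3P[/subsetP SF _ _]; apply: SF.
  (* Conversely, triangles of [famX Y k] use only members of [famX' Y k], so all of them lie in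
     [F]. *)
  apply/eqP; rewrite -(n3E k Y3) eqn_leq (subset_leq_card (triS _ _ FY)).
  apply/subset_leq_card/subsetP=> S SY; have S' := triangles_famX_sub Y3 SY.
  by move: SY; rewrite !inE => /and3P[_ -> ->]; rewrite (subset_trans S').
move=> /existsPn nX.
have nX' (X : {set 'I_n}) : #|X| = 3 -> ~~ (F \subset famX X k).
  by move=> X3; have := nX X; rewrite X3 eqxx.
have n3_ge : trace_deg 'I_n k * ((trace_deg 'I_n k - k * codeg3 'I_n k)
                                 * trace_deg 'I_n k) <= n3 n k.
  have n3' : 2 < n by have := leq_3k_card k2 nk'; rewrite card_ord; lia.
  pose x := Ordinal (ltnW (ltnW n3')); pose y := Ordinal (ltnW n3').
  pose z := Ordinal n3'.
  have X3 : #|[set x; y; z]| = 3 by apply: cards3.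
  by rewrite -(n3E k X3) leq_card_triangles_famX.
have lt : #|triangles F| < n3 n k.
  (* Without triangles, positivity of the lower bound suffices; otherwise a triangle supplies a
     member avoiding any given point. *)
  apply: leq_trans n3_ge; have [T0|/set0Pn[S ST]] := eqVneq (triangles F) set0.
    by rewrite T0 cards0 !muln_gt0 subn_gt0 (trace_deg_gt0 k2 nk') codeg3_lt.
  apply: triangles_lt => // x.
  have [A AS xA] := triangle_avoids x ST; exists A => //; exact: sub_triangle ST AS.
split; first exact: ltnW.
split=> [e|[X [X3 [_ FX]]]]; first by rewrite e ltnn in lt.
by have := nX' X X3; rewrite FX.
Qed.
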